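(* For every integer $n\ge 1$, the derived length of the subgroup $\mathcal B_n$ of $\mathrm{Bir}(\mathbb P^n)$ is equal to $2n$.
   Context: $\mathrm{Bir}(\mathbb P^n)$ is the group of birational transformations of complex projective $n$-space, identified with $\mathrm{Bir}(\mathbb A^n)$ via $(x_1,\dots,x_n)\mapsto[x_1:\dots:x_n:1]$; elements are written $f=(f_1,\dots,f_n)$ with $f_i\in\mathbb C(x_1,\dots,x_n)$. $\mathcal B_n\subseteq\mathrm{Bir}(\mathbb P^n)$ is the subgroup of all $f=(f_1,\dots,f_n)$ with $f_i=a_ix_i+b_i$, where $a_i,b_i\in\mathbb C(x_{i+1},\dots,x_n)$ and $a_i\neq0$ (so $a_n,b_n\in\mathbb C$). For a group $G$, $D(G)$ is the subgroup generated by commutators, $D^0(G)=G$, $D^k(G)=D(D^{k-1}(G))$; the derived length of a solvable group $G$ is the smallest integer $k\ge0$ with $D^k(G)=\{1\}$. *)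

(* Defs.v *)
From HB Require Import structures.
From mathcomp Require Import all_boot all_order all_algebra.
From mathcomp Require Import boolp classical_sets reals complex mpoly.

Set Implicit Arguments.
Unset Strict Implicit.
Unset Printing Implicit Defensive.

Import GRing.Theory.
Local Open Scope ring_scope.

Section RationalMaps.
Variables (K : fieldType) (n : nat).

Local Notation ratfun := {fraction {mpoly K[n]}}.
Local Notation tofrac := (@FracField.tofrac {mpoly K[n]}).
Local Notation ratmap := {ffun 'I_n -> ratfun}.
Implicit Types (f g h : ratmap) (p q : {mpoly K[n]}) (u v : ratfun).

Definition ratvar (i : 'I_n) : ratfun := tofrac 'X_i.

Definition polysubst f p : ratfun := mmap (tofrac \o @mpolyC n K) f p.

(* [p] ranges over the equations of hypersurfaces of A^n: the image of [f] is
   contained in none of them, that is, it is Zariski dense. *)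
Definition dominant f : Prop := forall p, p != 0 -> polysubst f p != 0.

(* u(f_1, ..., f_n), computed on some fraction representing [u]; when [f] is
   dominant the denominator does not vanish and the result does not depend on
   the chosen fraction (see [ratsubst_frac] below). *)
Definition ratsubst f u : ratfun :=
  polysubst f \n_(repr u) / polysubst f \d_(repr u).

(* The composition x |-> f (g x), meaningful when [g] is dominant. *)
Definition ratcomp f g : ratmap := [ffun i => ratsubst g (f i)].
Definition ratid : ratmap := [ffun i => ratvar i].

Definition birational f : Prop :=
  dominant f /\
  exists g, [/\ dominant g, ratcomp f g = ratid & ratcomp g f = ratid].

Lemma polysubst_is_zmod_morphism f : zmod_morphism (polysubst f).
Proof. by move=> p q; rewrite /polysubst raddfB. Qed.
Lemma polysubst_is_monoid_morphism f : monoid_morphism (polysubst f).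
Proof. by rewrite /polysubst; split=> [|p q]; rewrite ?rmorph1 ?rmorphM. Qed.
HB.instance Definition _ f := GRing.isZmodMorphism.Build {mpoly K[n]} ratfun
  (polysubst f) (polysubst_is_zmod_morphism f).
HB.instance Definition _ f := GRing.isMonoidMorphism.Build {mpoly K[n]} ratfun
  (polysubst f) (polysubst_is_monoid_morphism f).

Lemma polysubstC f c : polysubst f c%:MP = tofrac c%:MP.
Proof. by rewrite /polysubst mmapC. Qed.

Lemma polysubstX f i : polysubst f 'X_i = f i.
Proof. by rewrite /polysubst mmapX mmap1U. Qed.

Lemma polysubstE f p : polysubst f p =
  \sum_(m <- msupp p) tofrac (p@_m)%:MP * \prod_(i < n) f i ^+ m i.
Proof. by []. Qed.

Lemma polysubst_id p : polysubst ratid p = tofrac p.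
Proof.
rewrite polysubstE {3}[p]mpolyE rmorph_sum; apply: eq_bigr => m _.
rewrite /= -mul_mpolyC rmorphM; congr (_ * _).
rewrite mpolyXE_id rmorph_prod; apply: eq_bigr => i _.
by rewrite rmorphXn ffunE.
Qed.

Lemma ratfunE u : u = tofrac \n_(repr u) / tofrac \d_(repr u).
Proof.
have nz : tofrac \d_(repr u) != 0 :> ratfun by rewrite tofrac_eq0 denom_ratioP.
apply: (mulIf nz); rewrite divfK //.
rewrite -{1}[u]reprK; move: (repr u) => x {nz}; unlock FracField.tofrac.
rewrite -[LHS]FracField.pi_mul; apply/eqmodP; rewrite /= FracField.equivfE.
rewrite /FracField.mulf !numden_Ratio ?mulr1 ?mul1r ?oner_neq0 ?denom_ratioP //.
by rewrite mulrC.
Qed.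

Lemma ratsubst_frac f p q : dominant f -> q != 0 ->
  ratsubst f (tofrac p / tofrac q) = polysubst f p / polysubst f q.
Proof.
move=> domf nzq; set u := _ / _; rewrite /ratsubst.
have nzd : \d_(repr u) != 0 := denom_ratioP _.
have E : \n_(repr u) * q = p * \d_(repr u).
  apply/eqP; rewrite -tofrac_eq !rmorphM.
  rewrite -eqr_div ?tofrac_eq0 //; by rewrite -ratfunE.
apply/eqP; rewrite eqr_div ?domf // -!rmorphM E; exact/eqP.
Qed.

Section Morphism.
Variables (f : ratmap) (domf : dominant f).

Definition ratsubst_morph of dominant f : ratfun -> ratfun := ratsubst f.

Lemma ratsubst_poly p : ratsubst f (tofrac p) = polysubst f p.
Proof.
by rewrite -[tofrac p]divr1 -(rmorph1 tofrac) ratsubst_frac ?oner_neq0 //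
  rmorph1 divr1.
Qed.

Lemma ratsubst_is_zmod_morphism : zmod_morphism (ratsubst_morph domf).
Proof.
move=> u v; rewrite /ratsubst_morph {1}[u]ratfunE {1}[v]ratfunE.
have nzu : \d_(repr u) != 0 := denom_ratioP _.
have nzv : \d_(repr v) != 0 := denom_ratioP _.
rewrite -mulNr -(rmorphN tofrac) addf_div ?tofrac_eq0 //.
rewrite -!(rmorphM tofrac) -(rmorphD tofrac) ratsubst_frac ?mulf_neq0 //.
rewrite /ratsubst -[in RHS]mulNr addf_div ?domf //.
by rewrite rmorphD !rmorphM rmorphN.
Qed.

Lemma ratsubst_is_monoid_morphism : monoid_morphism (ratsubst_morph domf).
Proof.
split=> [|u v]; first by rewrite /ratsubst_morph
  -[X in ratsubst f X](rmorph1 tofrac) ratsubst_poly rmorph1.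
rewrite /ratsubst_morph {1}[u]ratfunE {1}[v]ratfunE mulf_div -!(rmorphM tofrac).
by rewrite ratsubst_frac ?mulf_neq0 ?denom_ratioP // /ratsubst mulf_div !rmorphM.
Qed.

HB.instance Definition _ := GRing.isZmodMorphism.Build ratfun ratfun
  (ratsubst_morph domf) ratsubst_is_zmod_morphism.
HB.instance Definition _ := GRing.isMonoidMorphism.Build ratfun ratfun
  (ratsubst_morph domf) ratsubst_is_monoid_morphism.

Lemma ratsubst_polysubst g p :
  ratsubst f (polysubst g p) = polysubst (ratcomp g f) p.
Proof.
rewrite -[ratsubst f]/(ratsubst_morph domf) !polysubstE rmorph_sum.
apply: eq_bigr => m _; rewrite rmorphM rmorph_prod /=; congr (_ * _).
  by rewrite /ratsubst_morph ratsubst_poly polysubstC.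
by apply: eq_bigr => i _; rewrite rmorphXn ffunE.
Qed.

Lemma dominant_comp g : dominant g -> dominant (ratcomp g f).
Proof.
move=> domg p nzp; rewrite -ratsubst_polysubst.
by rewrite -[ratsubst f]/(ratsubst_morph domf) fmorph_eq0 domg.
Qed.

Lemma ratsubst_comp g u :
  ratsubst f (ratsubst g u) = ratsubst (ratcomp g f) u.
Proof.
rewrite [ratsubst g u]/ratsubst [RHS]/ratsubst -!ratsubst_polysubst.
exact: (fmorph_div (ratsubst_morph domf)).
Qed.

Lemma ratcompA h g : ratcomp h (ratcomp g f) = ratcomp (ratcomp h g) f.
Proof. by apply/ffunP => i; rewrite !ffunE ratsubst_comp. Qed.

End Morphism.

Lemma dominant_id : dominant ratid.
Proof. by move=> p nzp; rewrite polysubst_id tofrac_eq0. Qed.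

Lemma ratcomp1r f : dominant f -> ratcomp ratid f = f.
Proof.
by move=> domf; apply/ffunP => i; rewrite !ffunE ratsubst_poly ?polysubstX.
Qed.

Lemma ratcompr1 f : ratcomp f ratid = f.
Proof.
by apply/ffunP => i; rewrite !ffunE /ratsubst !polysubst_id -ratfunE.
Qed.

Lemma birational_id : birational ratid.
Proof.
split; first exact: dominant_id.
by exists ratid; split; rewrite ?ratcompr1 //; exact: dominant_id.
Qed.

Lemma birational_comp f g :
  birational f -> birational g -> birational (ratcomp f g).
Proof.
move=> [domf [f' [domf' ff' f'f]]] [domg [g' [domg' gg' g'g]]].
split; first exact: dominant_comp.
exists (ratcomp g' f'); split; first exact: dominant_comp.
- have -> := ratcompA domf' (ratcomp f g) g'.
  by have <- := ratcompA domg' f g; rewrite gg' ratcompr1.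
- have -> := ratcompA domg (ratcomp g' f') f.
  by have <- := ratcompA domf g' f'; rewrite f'f ratcompr1.
Qed.

(* Bir(A^n), which is Bir(P^n) through (x_1, ..., x_n) |-> [x_1 : ... : x_n : 1];
   the group law is composition, x * y being the map p |-> x (y p). *)
Record bir := Bir { bir_map :> ratmap; _ : `[< birational bir_map >] }.

HB.instance Definition _ := [isSub for bir_map].
HB.instance Definition _ := [Choice of bir by <:].

Lemma bir_birational (x : bir) : birational x.
Proof. by case: x => f bf; apply: asboolW. Qed.

Definition bir1 : bir := Bir (asboolT birational_id).
Definition bir_mul (x y : bir) : bir :=
  Bir (asboolT (birational_comp (bir_birational x) (bir_birational y))).

Lemma bir_has_inv (x : bir) : exists y, bir_mul y x = bir1 /\ bir_mul x y = bir1.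
Proof.
have [domx [g [domg xg gx]]] := bir_birational x.
have bg : birational g by split=> //; exists x.
by exists (Bir (asboolT bg)); split; apply: val_inj.
Qed.

Definition bir_inv (x : bir) : bir := projT1 (cid (bir_has_inv x)).

Lemma bir_mulA : associative bir_mul.
Proof.
move=> x y z; apply: val_inj; apply: ratcompA.
  by case: (bir_birational z).
Qed.

Lemma bir_mul1 : left_id bir1 bir_mul.
Proof.
by move=> x; apply: val_inj; apply: ratcomp1r; case: (bir_birational x).
Qed.

Lemma bir_mulr1 : right_id bir1 bir_mul.
Proof. by move=> x; apply: val_inj; apply: ratcompr1. Qed.

Lemma bir_mulV : left_inverse bir1 bir_inv bir_mul.
Proof. by move=> x; rewrite /bir_inv; case: cid => y []. Qed.

Lemma bir_mulrV : right_inverse bir1 bir_inv bir_mul.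
Proof. by move=> x; rewrite /bir_inv; case: cid => y []. Qed.

HB.instance Definition _ := isGroup.Build bir
  bir_mulA bir_mul1 bir_mulr1 bir_mulV bir_mulrV.

Definition poly_after (i : 'I_n) p : Prop :=
  forall m, m \in msupp p -> forall j : 'I_n, (j <= i)%N -> m j = 0%N.

(* The subfield K(x_{i+1}, ..., x_n) of K(x_1, ..., x_n): fractions of
   polynomials in which x_1, ..., x_i do not occur. *)
Definition ratfun_after (i : 'I_n) : set ratfun :=
  [set u | exists p q, [/\ poly_after i p, poly_after i q, q != 0 &
                           u = tofrac p / tofrac q]].

(* The group B_n; that it is a subgroup is [triangular_bir_subgroup] below. *)
Definition triangular_bir : set bir :=
  [set f | forall i, exists a b,
     [/\ ratfun_after i a, ratfun_after i b, a != 0 &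
         bir_map f i = a * ratvar i + b]].

Section After.
Variable i : 'I_n.

Lemma poly_afterC c : poly_after i c%:MP.
Proof.
move=> m; rewrite msuppC; case: ifP => // _ /[!inE] /eqP -> j _.
by rewrite mnmE.
Qed.

Lemma poly_afterD p q : poly_after i p -> poly_after i q -> poly_after i (p + q).
Proof.
by move=> hp hq m /msuppD_le; rewrite mem_cat => /orP[/hp|/hq].
Qed.

Lemma poly_afterM p q : poly_after i p -> poly_after i q -> poly_after i (p * q).
Proof.
move=> hp hq m /msuppM_le /allpairsP[[m1 m2] /= [/hp h1 /hq h2 ->]] j ji.
by rewrite mnmDE h1 ?h2.
Qed.

Lemma ratfun_afterC c : ratfun_after i (tofrac c%:MP).
Proof.
exists c%:MP, 1; split; rewrite ?oner_neq0 ?rmorph1 ?divr1 //.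
  exact: poly_afterC.
by rewrite -mpolyC1; apply: poly_afterC.
Qed.

Lemma ratfun_after1 : ratfun_after i 1.
Proof. by have := ratfun_afterC 1; rewrite !rmorph1. Qed.

Lemma ratfun_afterD u v :
  ratfun_after i u -> ratfun_after i v -> ratfun_after i (u + v).
Proof.
move=> [p [q [hp hq nzq ->]]] [p' [q' [hp' hq' nzq' ->]]].
exists (p * q' + p' * q), (q * q'); split; rewrite ?mulf_neq0 //.
- by apply: poly_afterD; apply: poly_afterM.
- exact: poly_afterM.
- by rewrite addf_div ?tofrac_eq0 // -!(rmorphM tofrac) -(rmorphD tofrac).
Qed.

Lemma ratfun_afterM u v :
  ratfun_after i u -> ratfun_after i v -> ratfun_after i (u * v).
Proof.
move=> [p [q [hp hq nzq ->]]] [p' [q' [hp' hq' nzq' ->]]].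
exists (p * p'), (q * q'); split; rewrite ?mulf_neq0 //.
- exact: poly_afterM.
- exact: poly_afterM.
- by rewrite mulf_div -!(rmorphM tofrac).
Qed.

Lemma ratfun_afterV u : ratfun_after i u -> ratfun_after i u^-1.
Proof.
move=> [p [q [hp hq nzq ->]]]; have [->|nzp] := eqVneq p 0.
  rewrite rmorph0 mul0r invr0 -(rmorph0 tofrac) -[0]mpolyC0.
  exact: ratfun_afterC.
by exists q, p; split; rewrite ?invf_div.
Qed.

Lemma ratfun_afterN u : ratfun_after i u -> ratfun_after i (- u).
Proof.
rewrite -mulN1r; apply: ratfun_afterM.
by have := ratfun_afterC (-1); rewrite !rmorphN !rmorph1.
Qed.

Lemma ratfun_after_var (j : 'I_n) : (i < j)%N -> ratfun_after i (ratvar j).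
Proof.
move=> ij; exists 'X_j, 1; split; rewrite ?oner_neq0 ?rmorph1 ?divr1 //.
  move=> m; rewrite msuppX inE => /eqP -> k ki; rewrite mnm1E.
  by case: eqP => // jk; rewrite -jk leqNgt ij in ki.
by rewrite -mpolyC1; apply: poly_afterC.
Qed.

Lemma ratfun_after_le (j : 'I_n) u :
  (i <= j)%N -> ratfun_after j u -> ratfun_after i u.
Proof.
move=> ij [p [q [hp hq nzq ->]]]; exists p, q; split=> // m hm k ki.
  by apply: hp hm _ _; apply: leq_trans ki ij.
by apply: hq hm _ _; apply: leq_trans ki ij.
Qed.

Lemma ratfun_after_polysubst g p :
  (forall j : 'I_n, (i < j)%N -> ratfun_after i (g j)) ->
  poly_after i p -> ratfun_after i (polysubst g p).
Proof.
move=> hg hp; rewrite polysubstE big_seq.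
elim/big_ind: _ => [|u v|m hm].
- by rewrite -(rmorph0 tofrac) -[0]mpolyC0; apply: ratfun_afterC.
- exact: ratfun_afterD.
apply: ratfun_afterM; first exact: ratfun_afterC.
elim/big_ind: _ => [|u v|j _]; [exact: ratfun_after1|exact: ratfun_afterM|].
have [ji|ij] := leqP j i; first by rewrite (hp m hm j ji) expr0; apply: ratfun_after1.
elim: (m j) => [|k IHk]; first by rewrite expr0; apply: ratfun_after1.
by rewrite exprS; apply: ratfun_afterM => //; apply: hg.
Qed.

Lemma ratfun_after_subst g u : dominant g ->
  (forall j : 'I_n, (i < j)%N -> ratfun_after i (g j)) ->
  ratfun_after i u -> ratfun_after i (ratsubst g u).
Proof.
move=> domg hg [p [q [hp hq nzq ->]]]; rewrite ratsubst_frac //.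
by apply: ratfun_afterM; [|apply: ratfun_afterV];
  apply: ratfun_after_polysubst.
Qed.

End After.

Lemma triangular_after (f : bir) (i : 'I_n) :
  (forall j : 'I_n, (i < j)%N -> exists a b,
     [/\ ratfun_after j a, ratfun_after j b, a != 0 &
         bir_map f j = a * ratvar j + b]) ->
  forall j : 'I_n, (i < j)%N -> ratfun_after i (bir_map f j).
Proof.
move=> hf j ij; have [a [b [ha hb _ ->]]] := hf j ij.
apply: ratfun_afterD; last exact: ratfun_after_le (ltnW ij) hb.
apply: ratfun_afterM; first exact: ratfun_after_le (ltnW ij) ha.
exact: ratfun_after_var.
Qed.

Lemma ratsubst_affine (f : ratmap) (domf : dominant f) (a b : ratfun) i :
  ratsubst f (a * ratvar i + b) = ratsubst f a * f i + ratsubst f b.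
Proof.
have -> : ratsubst f (a * ratvar i + b)
        = ratsubst f a * ratsubst f (ratvar i) + ratsubst f b.
  rewrite -!/(ratsubst_morph domf _).
  by rewrite (rmorphD (ratsubst_morph domf)) (rmorphM (ratsubst_morph domf)).
by rewrite (ratsubst_poly domf) polysubstX.
Qed.

Lemma ratsubst_neq0 (f : ratmap) (domf : dominant f) (a : ratfun) :
  a != 0 -> ratsubst f a != 0.
Proof. by move=> nza; rewrite (fmorph_eq0 (ratsubst_morph domf)). Qed.

Lemma triangular_bir1 : triangular_bir bir1.
Proof.
move=> i; exists 1, 0; rewrite oner_neq0 mul1r addr0 ffunE.
split=> //; first exact: ratfun_after1.
by rewrite -(rmorph0 tofrac) -[0]mpolyC0; apply: ratfun_afterC.
Qed.

Lemma triangular_birM (f g : bir) :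
  triangular_bir f -> triangular_bir g -> triangular_bir (bir_mul f g).
Proof.
move=> hf hg i; have [a [b [ha hb nza fE]]] := hf i.
have [a' [b' [ha' hb' nza' gE]]] := hg i.
have [domg _] := bir_birational g.
have hgi := @triangular_after g i (fun j _ => hg j).
exists (ratsubst g a * a'), (ratsubst g a * b' + ratsubst g b).
have ha2 := ratfun_after_subst domg hgi ha.
have hb2 := ratfun_after_subst domg hgi hb.
split.
- exact: ratfun_afterM.
- by apply: ratfun_afterD => //; apply: ratfun_afterM.
- by apply: mulf_neq0 nza'; apply: ratsubst_neq0 domg _ nza.
- rewrite [LHS]ffunE fE (ratsubst_affine domg) gE mulrDr mulrA.
  exact/esym/addrA.
Qed.

Lemma triangular_birV (f : bir) : triangular_bir f -> triangular_bir (bir_inv f).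
Proof.
move=> hf; set g := bir_inv f; have [domg _] := bir_birational g.
have fg : bir_mul f g = bir1 by apply: bir_mulrV.
move=> i; have [k] := ubnP (n - i); elim: k i => // k IHk i lek.
have hgi : forall j : 'I_n, (i < j)%N -> ratfun_after i (bir_map g j).
  apply: triangular_after => j ij; apply: IHk.
  by move: lek; rewrite ltnS; apply/leq_trans/ltn_sub2l.
have [a [b [ha hb nza fE]]] := hf i.
have ha2 := ratfun_after_subst domg hgi ha.
have hb2 := ratfun_after_subst domg hgi hb.
have nza2 := ratsubst_neq0 domg nza.
have xE : ratsubst g a * bir_map g i + ratsubst g b = ratvar i.
  rewrite -(ratsubst_affine domg) -fE.
  have := congr1 (fun h : bir => bir_map h i) fg.
  by rewrite [LHS]ffunE [RHS]ffunE.
exists (ratsubst g a)^-1, (- ((ratsubst g a)^-1 * ratsubst g b)).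
split.
- exact: ratfun_afterV.
- by apply: ratfun_afterN; apply: ratfun_afterM hb2; apply: ratfun_afterV.
- by rewrite invr_eq0.
- by rewrite -xE mulrDr addrK mulKf.
Qed.

End RationalMaps.

Arguments triangular_bir K n : clear implicits.

Section DerivedSeries.
Local Open Scope group_scope.
Local Open Scope classical_set_scope.
Variable G : groupType.
Implicit Types H S : set G.

Definition is_subgroup S : Prop :=
  [/\ S 1, forall x y, S x -> S y -> S (x * y) & forall x, S x -> S x^-1].

Definition derived_subgroup H : set G :=
  smallest is_subgroup [set z | exists x y, [/\ H x, H y & z = [~ x, y]]].

Definition derived_series (k : nat) H : set G := iter k derived_subgroup H.

Definition has_derived_length H (k : nat) : Prop :=
  derived_series k H = [set 1] /\
  forall j, derived_series j H = [set 1] -> (k <= j)%N.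

End DerivedSeries.

Lemma triangular_bir_subgroup (K : fieldType) (n : nat) :
  is_subgroup (triangular_bir K n).
Proof.
split; [exact: triangular_bir1|exact: triangular_birM|exact: triangular_birV].
Qed.

(* Main.v *)
(* Upper bound: on maps fixing x_{i+1}, ..., x_n, the i-th coordinate is an
   affine transformation of the line over K(x_{i+1}, ..., x_n). Commutators of
   such maps act on x_i by translations, and commutators of the latter fix x_i;
   so each coordinate costs two derivation steps.

   Lower bound: by descending induction on i, D^k contains every translation
   x_i |-> x_i + b with b in K(x_{i+1}, ..., x_n) as long as k <= 2(n-i) + 1.
   The commutator of x_i |-> a x_i with such translations yields all of them
   again when a <> 1, so it suffices that D^k contains one nontrivial scaling
   of x_i for each k <= 2(n-i). Commutators with x_{i+1} |-> x_{i+1} - 1 turn a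
   scaling by a(x_{i+1}) into one by a(x_{i+1} - 1) / a(x_{i+1}); starting from
   a = x_{i+1} and iterating, the factor never becomes trivial. *)
Require Import Defs.
From HB Require Import structures.
From mathcomp Require Import all_boot all_order all_algebra.
From mathcomp Require Import ring.
From mathcomp Require Import boolp classical_sets reals complex mpoly.

Set Implicit Arguments.
Unset Strict Implicit.
Unset Printing Implicit Defensive.

Import GRing.Theory.
Local Open Scope ring_scope.

(** * Derived subgroups through commutator relations *)

Section DerivedSeriesTheory.
Local Open Scope group_scope.
Local Open Scope classical_set_scope.
Variable G : groupType.
Implicit Types H S : set G.

Lemma derived_subgroup_is_subgroup H : is_subgroup (derived_subgroup H).
Proof.
split=> [S [[]]|x y Hx Hy S HS|x Hx S HS] //.
- by case: (HS) => -[_ SM _] _; exact: SM _ _ (Hx S HS) (Hy S HS).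
- by case: (HS) => -[_ _ SV] _; exact: SV _ (Hx S HS).
Qed.

(** The relation [x * y = y * x * z] expresses the commutator without inverses, which for birational
    maps come from a choice and have no explicit formula. *)
Lemma derived_subgroup_comm H x y z :
  H x -> H y -> x * y = y * x * z -> derived_subgroup H z.
Proof.
move=> Hx Hy e S [_]; apply; exists x, y; split=> //.
by apply: (mulgI (y * x)); rewrite -e -commgC.
Qed.

(** The bound [H'] on [H] lets inclusions propagate along the derived series, one derivation at a
    time. *)
Lemma derived_subgroup_min H H' S : H `<=` H' -> is_subgroup S ->
  (forall x y z, H' x -> H' y -> x * y = y * x * z -> S z) ->
  derived_subgroup H `<=` S.
Proof.
move=> sHH' subS commS z; apply; split=> // _ [x [y [Hx Hy ->]]].
by apply: (commS x y); rewrite -?commgC //; apply: sHH'.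
Qed.

Lemma derived_seriesS k H :
  derived_series k.+1 H = derived_subgroup (derived_series k H).
Proof. by []. Qed.

End DerivedSeriesTheory.

(* The unsimplified [1 *] and [+ 0] are those produced by composing the maps
   [x_i |-> a x_i + b] below. *)
Section FieldIdentities.
Variable F : fieldType.
Implicit Types a b c d q w x y : F.

Lemma eq_div_mul a b q : q != 0 -> a = b / q -> b = a * q.
Proof. by move=> nzq ->; rewrite divfK. Qed.

Lemma affine_comm_solve a b c d x y : a != 0 -> c != 0 ->
  a * (c * x + d) + b = a * c * y + (c * b + d) ->
  y = x + (a * d + b - (c * b + d)) / (a * c).
Proof.
move=> nza nzc E.
have -> : y = (a * (c * x + d) + b - (c * b + d)) / (a * c).
  by rewrite E; field; rewrite nza nzc.
by field; rewrite nza nzc.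
Qed.

(** Substitution of the inverse affine map once the denominators [c] of [a] and [d] of [b] have been
    cleared. *)
Lemma affine_inv_clear a b c d x : a != 0 ->
  a * c * d * (a^-1 * x - a^-1 * b) + b * d * c = x * (c * d).
Proof. by move=> nza; field. Qed.

Lemma affine_inv_cst a b : a != 0 -> a * - (a^-1 * b) + b = 0.
Proof. by move=> nza; field. Qed.

Lemma affine_comm_lin a : 1 * a = a * 1 * 1.
Proof. by rewrite mul1r !mulr1. Qed.

Lemma affine_comm_cst a b :
  a != 0 -> 1 * 0 + b = a * 1 * ((a^-1 - 1) * b) + (a * b + 0).
Proof. by move=> nza; field. Qed.

Lemma mulf_divK a b : a != 0 -> a * (b / a) = b.
Proof. by move=> nza; field. Qed.

End FieldIdentities.

Section Triangular.
Variables (K : fieldType) (n : nat).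

Local Notation ratfun := {fraction {mpoly K[n]}}.
Local Notation tofrac := (@FracField.tofrac {mpoly K[n]}).
Local Notation ratmap := {ffun 'I_n -> ratfun}.
Local Notation bir := (bir K n).
Implicit Types (f g h : ratmap) (p q : {mpoly K[n]}) (a b u v : ratfun).
Implicit Types (i j l : 'I_n).

(** * Substitutions that fix the later variables *)

Lemma bir_dominant (x : bir) : dominant (bir_map x).
Proof. by case: (bir_birational x). Qed.

Lemma bir_inj (x y : bir) : bir_map x = bir_map y -> x = y.
Proof. exact: val_inj. Qed.

Lemma ratfun_after0 i : ratfun_after i (0 : ratfun).
Proof. by rewrite -(rmorph0 tofrac) -[0]mpolyC0; apply: ratfun_afterC. Qed.

Lemma ratsubst_var f j : dominant f -> ratsubst f (ratvar K j) = f j.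
Proof. by move=> domf; rewrite ratsubst_poly ?polysubstX. Qed.

Lemma polysubst_after i f p : (forall j, (i < j)%N -> f j = ratvar K j) ->
  poly_after i p -> polysubst f p = tofrac p.
Proof.
move=> fE hp; rewrite -(polysubst_id p) !polysubstE.
apply: eq_big_seq => m hm; congr (_ * _); apply: eq_bigr => j _.
have [ji|ij] := leqP j i; first by rewrite (hp m hm j ji) !expr0.
by rewrite fE // ffunE.
Qed.

Lemma ratsubst_after i f u : dominant f ->
  (forall j, (i < j)%N -> f j = ratvar K j) ->
  ratfun_after i u -> ratsubst f u = u.
Proof.
move=> domf fE [p [q [hp hq nzq ->]]].
by rewrite ratsubst_frac // !(polysubst_after fE).
Qed.

(** * Upper bound: a descending chain of subgroups *)

Definition fixing_from (m : nat) : set bir :=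
  [set f | triangular_bir K n f /\
           forall j, (m <= j)%N -> bir_map f j = ratvar K j].

(** A group between [fixing_from i] and [fixing_from i.+1], playing the role of the translations
    inside the affine group of the line. *)
Definition translating_at i : set bir :=
  [set f | fixing_from i.+1 f /\
           exists2 b, ratfun_after i b & bir_map f i = ratvar K i + b].

Lemma ratsubst_fixing_from (f : bir) i u :
  fixing_from i.+1 f -> ratfun_after i u -> ratsubst (bir_map f) u = u.
Proof.
by move=> [_ fE]; apply: ratsubst_after fE; apply: bir_dominant.
Qed.

Lemma ratsubst_fixing_affine (f : bir) i a b : fixing_from i.+1 f ->
  ratfun_after i a -> ratfun_after i b ->
  ratsubst (bir_map f) (a * ratvar K i + b) = a * bir_map f i + b.
Proof.
move=> hf ha hb; rewrite ratsubst_affine; last exact: bir_dominant.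
by rewrite !(ratsubst_fixing_from hf).
Qed.

Lemma bir_mulE (x y : bir) i :
  bir_map (x * y)%g i = ratsubst (bir_map y) (bir_map x i).
Proof. by rewrite [LHS]ffunE. Qed.

Lemma fixing_from_subgroup m : is_subgroup (fixing_from m).
Proof.
have [B1 BM BV] := triangular_bir_subgroup K n.
split.
- by split=> // j _; rewrite ffunE.
- move=> x y [Bx xE] [By yE]; split; first exact: BM.
  move=> j mj; rewrite bir_mulE xE // ratsubst_var ?yE //.
  exact: bir_dominant.
- move=> x [Bx xE]; split; first exact: BV.
  (* As [x] fixes [x_j], the coordinate [j] of [x * x^-1 = 1] is that of the inverse. *)
  move=> j mj; have := congr1 (fun f : bir => bir_map f j) (mulgV x).
  rewrite bir_mulE xE // ratsubst_var; last exact: bir_dominant.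
  by move=> ->; rewrite ffunE.
Qed.

Lemma translating_at_subgroup i : is_subgroup (translating_at i).
Proof.
have [U1 UM UV] := fixing_from_subgroup i.+1.
split.
- split=> //; exists 0; first exact: ratfun_after0.
  by rewrite ffunE addr0.
- move=> x y [Ux [b hb xE]] [Uy [c hc yE]]; split; first exact: UM.
  exists (c + b); first exact: ratfun_afterD.
  rewrite bir_mulE xE -[ratvar K i]mul1r ratsubst_fixing_affine //.
    by rewrite yE !mul1r addrA.
  exact: ratfun_after1.
- move=> x [Ux [b hb xE]]; split; first exact: UV.
  exists (- b); first exact: ratfun_afterN.
  have := congr1 (fun f : bir => bir_map f i) (mulgV x).
  rewrite bir_mulE xE -[ratvar K i]mul1r ratsubst_fixing_affine //.
  + by rewrite ffunE !mul1r => <-; rewrite addrK.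
  + exact: UV.
  + exact: ratfun_after1.
Qed.

Lemma fixing_from_comm m (x y z : bir) :
  fixing_from m x -> fixing_from m y -> (x * y = y * x * z)%g ->
  fixing_from m z.
Proof.
move=> Ux Uy e; have [_ UM UV] := fixing_from_subgroup m.
have -> : z = ((y * x)^-1 * (x * y))%g by rewrite e mulKg.
exact: (UM _ _ (UV _ (UM _ _ Uy Ux)) (UM _ _ Ux Uy)).
Qed.

(* In the coordinate [x_i], the elements of [fixing_from i.+1] compose like
   affine maps of the line, as they act trivially on their coefficients. *)
Lemma fixing_from_commE i (x y z : bir) a b a' b' :
  fixing_from i.+1 x -> fixing_from i.+1 y -> (x * y = y * x * z)%g ->
  ratfun_after i a -> ratfun_after i b -> a != 0 ->
  ratfun_after i a' -> ratfun_after i b' -> a' != 0 ->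
  bir_map x i = a * ratvar K i + b -> bir_map y i = a' * ratvar K i + b' ->
  bir_map z i = ratvar K i + (a * b' + b - (a' * b + b')) / (a * a').
Proof.
move=> Ux Uy e ha hb nza ha' hb' nza' xE yE.
have Uz := fixing_from_comm Ux Uy e.
have := congr1 (fun f : bir => bir_map f i) e.
rewrite !bir_mulE xE yE !ratsubst_fixing_affine // xE yE.
have -> : a' * (a * ratvar K i + b) + b' = a' * a * ratvar K i + (a' * b + b').
  by rewrite mulrDr mulrA addrA.
rewrite ratsubst_fixing_affine; first 1 last.
- exact: Uz.
- exact: ratfun_afterM.
- by apply: ratfun_afterD => //; apply: ratfun_afterM.
rewrite [a' * a]mulrC; exact: affine_comm_solve nza nza'.
Qed.

(** The slopes lie in a commutative field, so they cancel in the commutator and leave slope 1. *)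
Lemma fixing_from_comm_translating i (x y z : bir) :
  fixing_from i.+1 x -> fixing_from i.+1 y -> (x * y = y * x * z)%g ->
  translating_at i z.
Proof.
move=> Ux Uy e; have [a [b [ha hb nza xE]]] := Ux.1 i.
have [a' [b' [ha' hb' nza' yE]]] := Uy.1 i.
split; first exact: fixing_from_comm Ux Uy e.
exists ((a * b' + b - (a' * b + b')) / (a * a')).
  apply: ratfun_afterM; last by apply/ratfun_afterV/ratfun_afterM.
  by apply: ratfun_afterD; last apply: ratfun_afterN;
    apply: ratfun_afterD => //; apply: ratfun_afterM.
exact: (fixing_from_commE Ux Uy e ha hb nza ha' hb' nza' xE yE).
Qed.

(** Both maps fix the translation terms, so in the coordinate [i] they commute like elements of an
    additive group. *)
Lemma translating_at_comm_fixing i (x y z : bir) :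
  translating_at i x -> translating_at i y -> (x * y = y * x * z)%g ->
  fixing_from i z.
Proof.
move=> [Ux [b hb xE]] [Uy [b' hb' yE]] e.
have [[Bz zE] _] := fixing_from_comm_translating Ux Uy e.
split=> // j; rewrite leq_eqVlt => /orP[/eqP ij|]; last exact: zE.
have <- : i = j by apply: val_inj.
have h1 := ratfun_after1 K i.
rewrite (fixing_from_commE Ux Uy e h1 hb (oner_neq0 _) h1 hb' (oner_neq0 _));
  rewrite ?mul1r //.
by rewrite [b' + b]addrC subrr mul0r addr0.
Qed.

Lemma derived_series_fixing_from k : (k <= n)%N ->
  (derived_series (2 * k) (triangular_bir K n) `<=` fixing_from (n - k))%classic.
Proof.
elim: k => [_ x Bx|k IHk lekn].
  split=> // j; rewrite subn0 leqNgt ltn_ord //.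
have lt_in : (n - k.+1 < n)%N by rewrite ltn_subrL (leq_trans _ lekn).
(* The last coordinate that [fixing_from (n - k)] lets move; the first derivation reduces it to
   translations, the second one fixes it. *)
pose i := Ordinal lt_in.
have iE : (n - k = i.+1)%N by rewrite /= -subSn // subSS.
rewrite mulnS add2n !derived_seriesS.
apply: (@derived_subgroup_min _ _ (translating_at i)).
- apply: (@derived_subgroup_min _ _ (fixing_from i.+1)).
  + by rewrite -iE; apply/IHk/ltnW.
  + exact: translating_at_subgroup.
  + exact: fixing_from_comm_translating.
- exact: fixing_from_subgroup.
- exact: translating_at_comm_fixing.
Qed.

Lemma derived_series_triangular_trivial :
  derived_series (2 * n) (triangular_bir K n) = [set 1%g]%classic.
Proof.
apply/seteqP; split=> [x Dx|_ ->].
  have [_ xE] := derived_series_fixing_from (leqnn n) Dx.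
  by apply: val_inj; apply/ffunP => j; rewrite ffunE xE // subnn.
case: (2 * n)%N => [|k]; first by case: (triangular_bir_subgroup K n).
by case: (derived_subgroup_is_subgroup (derived_series k (triangular_bir K n))).
Qed.

(** * Elementary maps and their commutators *)

Definition elem_map i a b : ratmap :=
  [ffun j => if j == i then a * ratvar K i + b else ratvar K j].

Lemma elem_map_eq i a b : elem_map i a b i = a * ratvar K i + b.
Proof. by rewrite ffunE eqxx. Qed.

Lemma elem_map_neq i a b j : j != i -> elem_map i a b j = ratvar K j.
Proof. by rewrite ffunE => /negbTE ->. Qed.

Lemma elem_map_gt i a b j : (i < j)%N -> elem_map i a b j = ratvar K j.
Proof. by move=> ij; apply: elem_map_neq; rewrite -val_eqE gtn_eqF. Qed.

(* Up to a denominator free of [x_1, ..., x_i], every polynomial [p] is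
   recovered from [p(f)] by substituting the inverse map. *)
Lemma dominant_elem_map i a b : ratfun_after i a -> ratfun_after i b ->
  a != 0 -> dominant (elem_map i a b).
Proof.
move=> ha hb nza; set f := elem_map i a b.
pose g := elem_map i a^-1 (- (a^-1 * b)).
(* Only polynomials are substituted here: [ratsubst] is known to be a morphism for dominant maps,
   and dominance is the goal. *)
pose C p := exists q r, [/\ poly_after i q, q != 0,
  polysubst f p * tofrac q = tofrac r & polysubst g r = tofrac (p * q)].
have gq q : poly_after i q -> polysubst g q = tofrac q.
  by apply: polysubst_after => j; apply: elem_map_gt.
have CD p p' : C p -> C p' -> C (p + p').
  move=> [q [r [hq nzq fp gr]]] [q' [r' [hq' nzq' fp' gr']]].
  exists (q * q'), (r * q' + r' * q); split.
  - exact: poly_afterM.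
  - exact: mulf_neq0.
  - rewrite !(rmorphD, rmorphM) /= mulrDl -fp -fp' !mulrA.
    by congr (_ + _); rewrite mulrAC.
  - rewrite rmorphD !rmorphM /= gr gr' !gq // -!rmorphM -rmorphD /=.
    by congr tofrac; rewrite mulrDl !mulrA [p' * q * q']mulrAC.
have CM p p' : C p -> C p' -> C (p * p').
  move=> [q [r [hq nzq fp gr]]] [q' [r' [hq' nzq' fp' gr']]].
  exists (q * q'), (r * r'); split.
  - exact: poly_afterM.
  - exact: mulf_neq0.
  - by rewrite !rmorphM /= -fp -fp' mulrACA.
  - by rewrite !rmorphM /= gr gr' !rmorphM mulrACA.
have hq1 : poly_after i (1 : {mpoly K[n]}).
  by rewrite -mpolyC1; apply: poly_afterC.
have CC c : C c%:MP.
  exists 1, c%:MP; rewrite oner_neq0 !rmorph1 !mulr1 !polysubstC; split=> //.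
have CX j : C 'X_j.
  have [->|ji] := eqVneq j i; last first.
    exists 1, 'X_j; rewrite oner_neq0 !rmorph1 !mulr1 !polysubstX.
    by split=> //; rewrite elem_map_neq.
  have [p1 [q1 [hp1 hq1' nzq1 aE]]] := ha.
  have [p2 [q2 [hp2 hq2 nzq2 bE]]] := hb.
  have nz1 : tofrac q1 != 0 by rewrite tofrac_eq0.
  have nz2 : tofrac q2 != 0 by rewrite tofrac_eq0.
  have p1E := eq_div_mul nz1 aE.
  have p2E := eq_div_mul nz2 bE.
  (* The product [q1 * q2] is a common denominator of [a] and [b]; the second witness is the
     resulting numerator of [a x_i + b]. *)
  exists (q1 * q2), (p1 * q2 * 'X_i + p2 * q1); split.
  - exact: poly_afterM.
  - exact: mulf_neq0.
  - rewrite polysubstX elem_map_eq /ratvar !(rmorphD, rmorphM) /= p1E p2E.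
    rewrite mulrDl; congr (_ + _); last by rewrite mulrA mulrAC.
    by rewrite mulrAC !mulrA.
  - rewrite !(rmorphD, rmorphM) /= polysubstX !gq // elem_map_eq p1E p2E.
    exact: affine_inv_clear nza.
have Call p : C p.
  rewrite [p]mpolyE; elim/big_ind: _ => [|p1 p2|m _];
    [by rewrite -mpolyC0|exact: CD|].
  rewrite -mul_mpolyC mpolyXE_id; apply: (CM _ _ (CC _)).
  elim/big_ind: _ => [|p1 p2|j _]; [by rewrite -mpolyC1|exact: CM|].
  elim: (m j) => [|e IHe]; first by rewrite expr0 -mpolyC1.
  by rewrite exprS; exact: (CM _ _ (CX j) IHe).
(* If [p(f) = 0], then [r = 0], hence [p * q = 0] with [q] nonzero. *)
move=> p; apply: contraNneq => fp0; have [q [r [_ nzq]]] := Call p.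
rewrite fp0 mul0r => /esym/eqP; rewrite tofrac_eq0 => /eqP ->.
by rewrite rmorph0 => /esym/eqP; rewrite tofrac_eq0 mulf_eq0 (negbTE nzq) orbF.
Qed.

Lemma ratsubst_elem_map i a b u : ratfun_after i a -> ratfun_after i b ->
  a != 0 -> ratfun_after i u -> ratsubst (elem_map i a b) u = u.
Proof.
move=> ha hb nza; apply: ratsubst_after; first exact: dominant_elem_map.
by move=> j; apply: elem_map_gt.
Qed.

Lemma ratcomp_elem_map i a b a' b' :
  ratfun_after i a -> ratfun_after i b ->
  ratfun_after i a' -> ratfun_after i b' -> a' != 0 ->
  ratcomp (elem_map i a b) (elem_map i a' b')
    = elem_map i (a * a') (a * b' + b).
Proof.
move=> ha hb ha' hb' nza'; have dom' := dominant_elem_map ha' hb' nza'.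
apply/ffunP => j; rewrite ffunE; have [->|ji] := eqVneq j i.
  rewrite !elem_map_eq ratsubst_affine // !ratsubst_elem_map // elem_map_eq.
  by rewrite mulrDr mulrA addrA.
by rewrite !elem_map_neq // ratsubst_var // elem_map_neq.
Qed.

Lemma elem_map1 i : elem_map i 1 0 = ratid K n.
Proof. by apply/ffunP => j; rewrite !ffunE mul1r addr0; case: eqP => [->|]. Qed.

Lemma birational_elem_map i a b : ratfun_after i a -> ratfun_after i b ->
  a != 0 -> birational (elem_map i a b).
Proof.
move=> ha hb nza; have hV := ratfun_afterV ha.
have hc : ratfun_after i (- (a^-1 * b)) by apply/ratfun_afterN/ratfun_afterM.
have nzV : a^-1 != 0 by rewrite invr_eq0.
split; first exact: dominant_elem_map ha hb nza.
exists (elem_map i a^-1 (- (a^-1 * b))).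
split; first exact: dominant_elem_map hV hc nzV.
- rewrite (ratcomp_elem_map ha hb hV hc nzV) (divff nza).
  rewrite (affine_inv_cst b nza); exact: elem_map1.
- by rewrite (ratcomp_elem_map hV hc ha hb nza) (mulVf nza) addrN elem_map1.
Qed.

Definition elem_coef i a b : Prop :=
  [/\ ratfun_after i a, ratfun_after i b & a != 0].

(** The identity serves as default value for inadmissible coefficients, so that [elem] is total and
    carries no proofs in its arguments. *)
Lemma elem_sig i a b :
  {x : bir | elem_coef i a b -> bir_map x = elem_map i a b}.
Proof.
have [[ha hb nza]|hab] := pselect (elem_coef i a b); last by exists 1%g.
by exists (Bir (asboolT (birational_elem_map ha hb nza))).
Qed.

Definition elem i a b : bir := sval (elem_sig i a b).

Lemma elemE i a b : elem_coef i a b -> bir_map (elem i a b) = elem_map i a b.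
Proof. exact: (svalP (elem_sig i a b)). Qed.

Lemma triangular_elem i a b :
  elem_coef i a b -> triangular_bir K n (elem i a b).
Proof.
move=> hab; have [ha hb nza] := hab; move=> j; rewrite elemE //.
have [->|ji] := eqVneq j i; first by exists a, b; rewrite elem_map_eq.
exists 1, 0; rewrite (elem_map_neq _ _ ji) mul1r addr0.
by split; [exact: ratfun_after1|exact: ratfun_after0|exact: oner_neq0|].
Qed.

Lemma elem_mul i a b a' b' : elem_coef i a b -> elem_coef i a' b' ->
  (elem i a b * elem i a' b')%g = elem i (a * a') (a * b' + b).
Proof.
move=> hab hab'; have [ha hb nza] := hab; have [ha' hb' nza'] := hab'.
have h : elem_coef i (a * a') (a * b' + b).
  split; [exact: ratfun_afterM| |exact: mulf_neq0 nza nza'].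
  exact: ratfun_afterD (ratfun_afterM ha hb') hb.
apply: bir_inj; apply: etrans (esym (elemE h)).
apply: etrans (f_equal2 (@ratcomp K n) (elemE hab) (elemE hab')) _.
exact: ratcomp_elem_map ha hb ha' hb' nza'.
Qed.

Definition scaling i a := elem i a 0.
Definition translation i b := elem i 1 b.

Lemma elem_coef_scaling i a : ratfun_after i a -> a != 0 -> elem_coef i a 0.
Proof. by split=> //; apply: ratfun_after0. Qed.

Lemma elem_coef_translation i b : ratfun_after i b -> elem_coef i 1 b.
Proof. by split; rewrite ?oner_neq0 //; apply: ratfun_after1. Qed.

(** Both sides send [x_i] to [a x_i + b]. For [a != 1] the factor [a^-1 - 1] is invertible, so every
    translation arises as such a commutator. *)
Lemma translation_scaling_comm i a b :
  ratfun_after i a -> a != 0 -> ratfun_after i b ->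
  (translation i b * scaling i a
     = scaling i a * translation i b * translation i ((a^-1 - 1) * b)%R)%g.
Proof.
move=> ha nza hb; have cs := elem_coef_scaling ha nza.
have ct := elem_coef_translation hb.
have ct' : elem_coef i 1 ((a^-1 - 1) * b).
  apply: elem_coef_translation; apply: ratfun_afterM => //.
  apply: ratfun_afterD; first exact: ratfun_afterV.
  by apply: ratfun_afterN; apply: ratfun_after1.
have cts : elem_coef i (a * 1) (a * b + 0).
  by rewrite mulr1 addr0; split=> //; apply: ratfun_afterM.
have E := etrans (congr1 (fun x : bir => x * _)%g (elem_mul cs ct))
  (elem_mul cts ct').
apply: etrans (elem_mul ct cs) (etrans _ (esym E)).
apply: f_equal2; [exact: affine_comm_lin|exact: affine_comm_cst].
Qed.

Lemma comm_elem_map i l a c s (x y z : bir) : (i < l)%N ->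
  ratfun_after i a -> a != 0 -> ratfun_after l c -> ratfun_after i s ->
  s != 0 -> a * s = ratsubst (elem_map l 1 c) a ->
  bir_map x = elem_map i a 0 -> bir_map y = elem_map l 1 c ->
  bir_map z = elem_map i s 0 -> (x * y = y * x * z)%g.
Proof.
move=> il ha nza hc hs nzs sE xE yE zE.
have h0 := ratfun_after0 i.
have [h1 _ nz1] := elem_coef_translation hc.
have domt := dominant_elem_map h1 hc nz1.
have doma := dominant_elem_map ha h0 nza.
have doms := dominant_elem_map hs h0 nzs.
have li : l != i by rewrite -val_eqE gtn_eqF.
have il' : i != l by rewrite eq_sym.
have fix_l u : ratfun_after l u -> [/\ ratsubst (elem_map l 1 c) u = u,
    ratsubst (elem_map i a 0) u = u & ratsubst (elem_map i s 0) u = u].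
  move=> hu; have hui := ratfun_after_le (ltnW il) hu.
  split; first exact: ratsubst_elem_map h1 hc nz1 hu.
    exact: ratsubst_elem_map ha h0 nza hui.
  exact: ratsubst_elem_map hs h0 nzs hui.
have [t0 a0 s0] := fix_l _ (ratfun_after0 l).
have [_ a1 s1] := fix_l _ h1.
have [_ ac sc] := fix_l _ hc.
apply: bir_inj; apply/ffunP => j; rewrite !bir_mulE xE yE zE.
have [->|ji] := eqVneq j i.
  rewrite (elem_map_neq _ _ il') (ratsubst_var _ doma) !elem_map_eq.
  rewrite (ratsubst_affine domt) (ratsubst_affine doms) t0 s0.
  rewrite (elem_map_neq _ _ il') elem_map_eq (ratsubst_elem_map hs h0 nzs ha).
  by rewrite !addr0 mulrA sE.
rewrite (elem_map_neq _ _ ji) (ratsubst_var _ domt).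
have [->|jl] := eqVneq j l; last first.
  by rewrite (elem_map_neq _ _ jl) (ratsubst_var _ doma) (elem_map_neq _ _ ji)
    (ratsubst_var _ doms) (elem_map_neq _ _ ji).
rewrite elem_map_eq (ratsubst_affine doma) a1 ac (elem_map_neq _ _ li).
by rewrite (ratsubst_affine doms) s1 sc (elem_map_neq _ _ li).
Qed.

Lemma scaling_translation_comm i l a c : (i < l)%N ->
  ratfun_after i a -> a != 0 -> ratfun_after l c ->
  (scaling i a * translation l c
     = translation l c * scaling i a *
       scaling i (ratsubst (elem_map l 1 c) a / a)%R)%g.
Proof.
move=> il ha nza hc; have cs := elem_coef_scaling ha nza.
have ct := elem_coef_translation hc; have [h1 _ nz1] := ct.
have domt := dominant_elem_map h1 hc nz1.
have nzt := ratsubst_neq0 domt nza.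
have hci := ratfun_after_le (ltnW il) hc.
(* The shift only changes [x_l], by an element free of [x_i] and all earlier variables, so the
   shifted [a] is still an admissible slope for [x_i]. *)
have hta : ratfun_after i (ratsubst (elem_map l 1 c) a).
  apply: ratfun_after_subst => // j ij; have [->|jl] := eqVneq j l.
    rewrite elem_map_eq mul1r; apply: ratfun_afterD => //.
    exact: ratfun_after_var.
  by rewrite elem_map_neq //; apply: ratfun_after_var.
have nzV := invr_neq0 nza.
have hs := ratfun_afterM hta (ratfun_afterV ha).
have nzs : ratsubst (elem_map l 1 c) a / a != 0 := mulf_neq0 nzt nzV.
exact: (comm_elem_map il ha nza hc hs nzs (mulf_divK _ nza) (elemE cs)
  (elemE ct) (elemE (elem_coef_scaling hs nzs))).
Qed.

(** * Polynomials in the single variable [x_l] *)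

Definition ratpoly l (P : {poly K}) : ratfun := tofrac (horner_alg 'X_l P).

Lemma ratpolyC l (c : K) : ratpoly l c%:P = tofrac c%:MP.
Proof. by rewrite /ratpoly horner_algC alg_mpolyC. Qed.

Lemma ratpolyX l : ratpoly l 'X = ratvar K l.
Proof. by rewrite /ratpoly horner_algX. Qed.

Lemma ratpolyM l (P Q : {poly K}) :
  ratpoly l (P * Q) = ratpoly l P * ratpoly l Q.
Proof. by rewrite /ratpoly !rmorphM. Qed.

Lemma ratpolyD l (P Q : {poly K}) :
  ratpoly l (P + Q) = ratpoly l P + ratpoly l Q.
Proof. by rewrite /ratpoly !rmorphD. Qed.

Lemma ratpolyN l (P : {poly K}) : ratpoly l (- P) = - ratpoly l P.
Proof. by rewrite /ratpoly !rmorphN. Qed.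

Lemma ratpoly1 l : ratpoly l 1 = 1.
Proof. by rewrite /ratpoly !rmorph1. Qed.

Lemma ratpolyMXaddC l (P : {poly K}) (c : K) :
  ratpoly l (P * 'X + c%:P) = ratpoly l P * ratvar K l + tofrac c%:MP.
Proof. by rewrite ratpolyD ratpolyM ratpolyX ratpolyC. Qed.

Lemma ratfun_after_ratpoly i l P : (i < l)%N -> ratfun_after i (ratpoly l P).
Proof.
move=> il; elim/poly_ind: P => [|P c IHP].
  by rewrite -polyC0 ratpolyC; apply: ratfun_afterC.
rewrite ratpolyMXaddC; apply: ratfun_afterD; last exact: ratfun_afterC.
by apply: ratfun_afterM => //; apply: ratfun_after_var.
Qed.

Lemma meval_horner_alg (v : 'I_n -> K) l (P : {poly K}) :
  meval v (horner_alg 'X_l P) = P.[v l].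
Proof.
elim/poly_ind: P => [|P c IHP]; first by rewrite !rmorph0 horner0.
rewrite rmorphD rmorphM /= horner_algX horner_algC alg_mpolyC.
by rewrite mevalD mevalM IHP mevalXU mevalC hornerMXaddC.
Qed.

(** Evaluation at the point with all coordinates equal to [z] detects nonvanishing, as only the
    coordinate [l] matters. *)
Lemma ratpoly_neq0 l (P : {poly K}) z : P.[z] != 0 -> ratpoly l P != 0.
Proof.
apply: contraNneq => /eqP; rewrite tofrac_eq0 => /eqP P0.
by rewrite -(meval_horner_alg (fun=> z) l) P0 meval0.
Qed.

Lemma ratsubst_shift_ratpoly l (P : {poly K}) :
  ratsubst (elem_map l 1 (- 1)) (ratpoly l P) = ratpoly l (P \Po ('X - 1%:P)).
Proof.
have h1 := ratfun_after1 K l; have hN1 := ratfun_afterN h1.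
have nz1 : 1 != 0 :> ratfun := oner_neq0 _.
have domf := dominant_elem_map h1 hN1 nz1.
have fixC c : ratsubst (elem_map l 1 (- 1)) (tofrac c%:MP) = tofrac c%:MP.
  exact: ratsubst_elem_map h1 hN1 nz1 (ratfun_afterC l c).
elim/poly_ind: P => [|P c IHP].
  by rewrite comp_poly0 -polyC0 ratpolyC fixC.
rewrite ratpolyMXaddC (ratsubst_affine domf) fixC IHP elem_map_eq.
rewrite comp_polyD comp_polyM comp_polyX comp_polyC ratpolyD ratpolyM ratpolyC.
by rewrite ratpolyD ratpolyX ratpolyN ratpoly1 mul1r.
Qed.

Lemma ratfun_after_divr i u v :
  ratfun_after i u -> ratfun_after i v -> ratfun_after i (u / v).
Proof. by move=> hu hv; apply: ratfun_afterM => //; apply: ratfun_afterV. Qed.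

(** * Lower bound in characteristic zero *)

Hypothesis natK_neq0 : forall m, m.+1%:R != 0 :> K.

Local Notation D k := (derived_series k (triangular_bir K n)).

(* The [r]-th multiplicative difference of [x_l] under the shift [x_l - 1]
   is kept nontrivial by looking at its largest integer zero [r]. *)
Lemma derived_series_scaling r i l : (i < l)%N ->
  (forall k, (k < r)%N -> D k (translation l (- 1))) ->
  exists P Q : {poly K}, [/\ P.[r%:R] = 0, Q.[r%:R] != 0,
    forall m, (r < m)%N -> P.[m%:R] != 0 /\ Q.[m%:R] != 0 &
    D r (scaling i (ratpoly l P / ratpoly l Q))].
Proof.
move=> il; elim: r => [_|r IHr DT].
  (* The initial factor is [x_l], which vanishes at 0 and, in characteristic zero, at no positive
     integer. *)
  exists 'X, 1; rewrite hornerX hornerC oner_neq0; split=> //.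
    by case=> // m _; rewrite hornerX hornerC oner_neq0.
  apply: triangular_elem; apply: elem_coef_scaling.
    by apply: ratfun_after_divr; apply: ratfun_after_ratpoly.
  apply: mulf_neq0; last apply: invr_neq0.
    by apply: (@ratpoly_neq0 _ _ 1); rewrite hornerX oner_neq0.
  by apply: (@ratpoly_neq0 _ _ 1); rewrite hornerC oner_neq0.
have [k lekr|P [Q [P0 Q0 PQ DPQ]]] := IHr; first exact/DT/ltnW.
have [PS QS] := PQ _ (ltnSn r).
have shift (A : {poly K}) m : (A \Po ('X - 1%:P)).[m.+1%:R] = A.[m%:R].
  by rewrite horner_comp !hornerE -natr1 addrK.
(* Numerator and denominator of [a(x_l - 1) / a(x_l)] for [a = P / Q]: the shift moves the zero of
   [P] from [r] to [r.+1]. *)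
exists ((P \Po ('X - 1%:P)) * Q), ((Q \Po ('X - 1%:P)) * P).
split.
- by rewrite hornerM shift P0 mul0r.
- by rewrite hornerM shift mulf_neq0.
- move=> [|m] //; rewrite ltnS => ltrm; rewrite !hornerM !shift.
  have [Pm Qm] := PQ _ ltrm; have [Pm1 Qm1] := PQ _ (leqW ltrm).
  by rewrite !mulf_neq0.
have nzP := ratpoly_neq0 l PS; have nzQ := ratpoly_neq0 l QS.
have h1 := ratfun_after1 K l; have hN1 := ratfun_afterN h1.
have nz1 : 1 != 0 :> ratfun := oner_neq0 _.
have domf := dominant_elem_map h1 hN1 nz1.
set a := ratpoly l P / ratpoly l Q.
have ha : ratfun_after i a.
  by apply: ratfun_after_divr; apply: ratfun_after_ratpoly.
have nza : a != 0 by apply: mulf_neq0 nzP (invr_neq0 nzQ).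
have E := scaling_translation_comm il ha nza hN1.
have ratsubst_div u v : ratsubst (elem_map l 1 (- 1)) (u / v) =
    ratsubst (elem_map l 1 (- 1)) u / ratsubst (elem_map l 1 (- 1)) v.
  exact: (fmorph_div (ratsubst_morph domf)).
have aE : ratsubst (elem_map l 1 (- 1)) a / a
    = ratpoly l ((P \Po ('X - 1%:P)) * Q) / ratpoly l ((Q \Po ('X - 1%:P)) * P).
  rewrite ratsubst_div !ratsubst_shift_ratpoly !ratpolyM.
  by rewrite /a invf_div mulf_div.
rewrite -aE; exact: derived_subgroup_comm DPQ (DT r (ltnSn r)) E.
Qed.

(** Commutators with one nontrivial scaling reproduce all translations, so one such scaling at each
    earlier level suffices. *)
Lemma derived_series_translation k i :
  (forall k', (k' < k)%N -> exists a,
     [/\ ratfun_after i a, a != 0, a != 1 & D k' (scaling i a)]) ->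
  forall b, ratfun_after i b -> D k (translation i b).
Proof.
elim: k => [_ b hb|k IHk Dscal b hb].
  exact/triangular_elem/elem_coef_translation.
have [a [ha nza a1 Da]] := Dscal k (ltnSn k).
have nzc : a^-1 - 1 != 0 by rewrite subr_eq0 invr_eq1.
have hc : ratfun_after i (a^-1 - 1).
  apply: ratfun_afterD; first exact: ratfun_afterV.
  exact/ratfun_afterN/ratfun_after1.
(* Translating by [b / (a^-1 - 1)] makes the commutator translate by exactly [b]. *)
have hbc := ratfun_after_divr hb hc.
have E := translation_scaling_comm ha nza hbc.
rewrite (mulf_divK b nzc) in E.
apply: (derived_subgroup_comm _ Da E); apply: IHk hbc => k' ltk'.
exact/Dscal/ltnW.
Qed.

(** Here [m] counts the variables after [x_i], and each of them adds two levels: shifts of the next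
    variable up to level [2m + 1] give scalings of [x_i] up to level [2m + 2], hence translations up
    to level [2m + 3]. *)
Lemma derived_series_translation_le m i k : n = (i + m.+1)%N ->
  (k <= (2 * m).+1)%N ->
  forall b, ratfun_after i b -> D k (translation i b).
Proof.
elim: m i k => [|m IHm] i k nE lek; apply: derived_series_translation => k' ltk.
  (* Without later variables only level 0 is required; scaling by 2 works, because 2 is neither 0
     nor 1. *)
  have -> : k' = 0%N by case: k' k lek ltk => [|k'] [|[|k]].
  pose two : ratfun := tofrac (2%:R : K)%:MP.
  have htwo : ratfun_after i two := ratfun_afterC i _.
  have nz : two != 0 by rewrite tofrac_eq0 mpolyC_eq0.
  exists two; split; [exact: htwo|exact: nz| |].
    rewrite -(rmorph1 tofrac) tofrac_eq -mpolyC1 mpolyC_eq.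
    by rewrite -subr_eq0 mulr2n addrK oner_neq0.
  exact: triangular_elem (elem_coef_scaling htwo nz).
have lt_ln : (i.+1 < n)%N by rewrite [ltnRHS]nE -2!addSnnS leq_addr.
pose l := Ordinal lt_ln; have il : (i < l)%N by [].
have [k2 ltk2|P [Q [P0 Q0 PQ Da]]] := @derived_series_scaling k' i l il.
  apply: IHm; first by rewrite [LHS]nE addSnnS.
    by have := leq_ltn_trans ltk2 (leq_trans ltk lek); rewrite mulnS.
  exact/ratfun_afterN/ratfun_after1.
have [PS QS] := PQ _ (ltnSn k').
have nzP := ratpoly_neq0 l PS; have nzQ := ratpoly_neq0 l QS.
exists (ratpoly l P / ratpoly l Q); split; last exact: Da.
- by apply: ratfun_after_divr; apply: ratfun_after_ratpoly.
- exact: mulf_neq0 nzP (invr_neq0 nzQ).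
(* At [k'] the polynomial [P] vanishes and [Q] does not, so their quotient is not 1. *)
- have nzPQ : (P - Q).[k'%:R] != 0 by rewrite hornerD hornerN P0 sub0r oppr_eq0.
  have := ratpoly_neq0 l nzPQ; apply: contraNneq => E.
  by rewrite ratpolyD ratpolyN -(divfK nzQ (ratpoly l P)) E mul1r addrN.
Qed.

(** The first variable is followed by [n - 1] others, so its unit translation survives up to level
    [2(n - 1) + 1 = 2n - 1]. *)
Lemma derived_series_triangular_neq1 k :
  (k < 2 * n)%N -> D k <> [set 1%g]%classic.
Proof.
case: (posnP n) => [->|n_gt0 ltk Dk1]; first by rewrite muln0.
pose i := Ordinal n_gt0; have h1 := ratfun_after1 K i.
have : D k (translation i 1).
  apply: (@derived_series_translation_le n.-1) => //; first by rewrite prednK.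
  by rewrite -ltnS -add2n -mulnS prednK.
rewrite Dk1 => E; have := congr1 (fun f : bir => bir_map f i) E.
rewrite /translation elemE; last exact: elem_coef_translation.
rewrite elem_map_eq ffunE mul1r => /eqP.
by rewrite -subr_eq0 addrC addKr oner_eq0.
Qed.

Lemma triangular_bir_derived_length :
  has_derived_length (triangular_bir K n) (2 * n).
Proof.
split; first exact: derived_series_triangular_trivial.
by move=> j; apply: contraPleq; apply: derived_series_triangular_neq1.
Qed.

End Triangular.

Local Open Scope complex_scope.

Theorem proposition1p4 (R : realType) (n : nat) (hn : (1 <= n)%N) :
  has_derived_length (triangular_bir R[i] n) (2 * n)%N.
Proof.
by apply: triangular_bir_derived_length => m; rewrite Num.Theory.pnatr_eq0.
Qed.
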